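(* Let $\{S_t\}_{t\ge0}$ be the weighted translation semigroup on $L^2(\mathbb{R}_+)$ with symbol $\varphi$. For every $t>0$, $\ker S_t^*=\chi_{[0,t)}L^2(\mathbb{R}_+)$. In particular, $\ker S_t^*$ is infinite dimensional.
   Context: $\mathbb{R}_+=[0,\infty)$, and $L^2(\mathbb{R}_+)$ is the Hilbert space of complex-valued square integrable Lebesgue measurable functions on $\mathbb{R}_+$. The symbol $\varphi:\mathbb{R}_+\to(0,\infty)$ is a positive continuous function such that for every $t\in\mathbb{R}_+$ the function $\varphi_t$, given by $\varphi_t(x)=\sqrt{\varphi(x)/\varphi(x-t)}$ for $x\ge t$ and $\varphi_t(x)=0$ for $x<t$, is essentially bounded. The weighted translation semigroup with symbol $\varphi$ is the family of bounded operators $\{S_t\}_{t\ge0}$ on $L^2(\mathbb{R}_+)$ given by $(S_tf)(x)=\sqrt{\varphi(x)/\varphi(x-t)}\,f(x-t)$ for $x\ge t$ and $(S_tf)(x)=0$ for $x<t$. $\chi_A$ denotes the characteristic function of the set $A$, and $\chi_AL^2(\mathbb{R}_+)=\{\chi_Af:f\in L^2(\mathbb{R}_+)\}$. *)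

(* Defs.v *)
From HB Require Import structures.
From mathcomp Require Import all_boot all_order all_algebra.
From mathcomp Require Import complex.
From mathcomp Require Import all_classical all_reals all_analysis.
From mathcomp Require Import measurable_realfun ess_sup_inf.
From mathcomp Require Import ring lra.

Set Implicit Arguments.
Unset Strict Implicit.
Unset Printing Implicit Defensive.

Import Order.TTheory GRing.Theory Num.Theory.
Import numFieldNormedType.Exports.

Local Open Scope classical_set_scope.
Local Open Scope ring_scope.
Local Open Scope quotient_scope.
Local Open Scope complex_scope.

Local Notation Re := complex.Re.
Local Notation Im := complex.Im.
Local Notation normc := ComplexField.Normc.normc.

(* Complex-valued functions take their values in R[i]^o, which is R[i] seen as a
   vector space over itself. *)

Section SquareIntegrable.
Context d (T : measurableType d) (R : realType).

Definition cmeasurable_fun (D : set T) (f : T -> R[i]^o) : Prop :=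
  measurable_fun D (fun x => Re (f x)) /\ measurable_fun D (fun x => Im (f x)).

Definition square_integrable (mu : {measure set T -> \bar R}) (D : set T)
    (f : T -> R[i]^o) : Prop :=
  cmeasurable_fun D f /\
  (\int[mu]_(x in D) (normc (f x) ^+ 2)%:E < +oo)%E.

Definition cintegral (mu : {measure set T -> \bar R}) (D : set T)
    (f : T -> R[i]) : R[i] :=
  (\int[mu]_(x in D) Re (f x)) +i* (\int[mu]_(x in D) Im (f x)).

Section closure.
Variables (mu : {measure set T -> \bar R}) (D : set T) (mD : measurable D).

Lemma normcE2 (z : R[i]) : normc z ^+ 2 = Re z ^+ 2 + Im z ^+ 2.
Proof. by case: z => a b /=; rewrite sqr_sqrtr// addr_ge0// sqr_ge0. Qed.

Lemma measurable_normc2 f : cmeasurable_fun D f ->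
  measurable_fun D (fun x => normc (f x) ^+ 2).
Proof.
move=> [mr mi].
rewrite (_ : (fun _ => _) = (fun x => Re (f x) ^+ 2 + Im (f x) ^+ 2)); last first.
  by apply/funext => x; exact: normcE2.
by apply: measurable_funD; apply: measurable_funX.
Qed.

Lemma square_integrable_submod_closed :
  submod_closed ((fun f => `[< square_integrable mu D f >]) : {pred (T -> R[i]^o)}).
Proof.
split.
  apply/asboolP; split; first by split; exact: measurable_cst.
  rewrite integral0_eq// => x _.
  by rewrite normcE2/= expr0n addr0.
move=> a f g /asboolP[mf intf] /asboolP[mg intg]; apply/asboolP.
have [mfr mfi] := mf; have [mgr mgi] := mg.
have mh : cmeasurable_fun D (a *: f + g).
  split.
    rewrite (_ : (fun _ => _) =
      (fun x => (Re a * Re (f x) - Im a * Im (f x)) + Re (g x))).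
      by apply: measurable_funD => //; apply: measurable_funB;
        exact: measurable_funM.
    apply/funext => x; rewrite /GRing.add/= /GRing.scale/=.
    by case: a (f x) (g x) => a1 a2 [b1 b2] [c1 c2].
  rewrite (_ : (fun _ => _) =
    (fun x => (Re a * Im (f x) + Im a * Re (f x)) + Im (g x))).
    by apply: measurable_funD => //; apply: measurable_funD;
      exact: measurable_funM.
  apply/funext => x; rewrite /GRing.add/= /GRing.scale/=.
  by case: a (f x) (g x) => a1 a2 [b1 b2] [c1 c2].
split=> //.
pose k := 2 * normc a ^+ 2.
have k0 : 0 <= k by rewrite mulr_ge0// sqr_ge0.
apply: (@le_lt_trans _ _ (\int[mu]_(x in D)
   (k%:E * (normc (f x) ^+ 2)%:E + 2%:E * (normc (g x) ^+ 2)%:E))%E).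
  apply: ge0_le_integral => //.
  - by move=> x _; rewrite lee_fin sqr_ge0.
  - by apply/measurable_EFinP; exact: measurable_normc2.
  - apply/measurable_EFinP; apply: measurable_funD;
      by apply: measurable_funM => //; exact: measurable_normc2.
  - move=> x _; rewrite -!EFinM -EFinD lee_fin.
    rewrite -[(a *: f + g) x]/(a * f x + g x) /k.
    have -> : normc a ^+ 2 = Re a ^+ 2 + Im a ^+ 2 by rewrite normcE2.
    rewrite !normcE2.
    case: a {k k0 mh} (f x) (g x) => a1 a2 [b1 b2] [c1 c2] /=.
    set u := a1 * b1 - a2 * b2; set v := a1 * b2 + a2 * b1.
    have -> : 2 * (a1 ^+ 2 + a2 ^+ 2) * (b1 ^+ 2 + b2 ^+ 2) =
              2 * (u ^+ 2 + v ^+ 2).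
      by rewrite /u /v; ring.
    have := sqr_ge0 (u - c1); have := sqr_ge0 (v - c2); nra.
rewrite ge0_integralD//.
- rewrite !ge0_integralZl_EFin//.
  + by rewrite lte_add_pinfty// lte_mul_pinfty// lee_fin.
  + by move=> x _; rewrite lee_fin sqr_ge0.
  + by apply/measurable_EFinP; exact: measurable_normc2.
  + by move=> x _; rewrite lee_fin sqr_ge0.
  + by apply/measurable_EFinP; exact: measurable_normc2.
- by move=> x _; rewrite mule_ge0// lee_fin ?sqr_ge0.
- apply/measurable_EFinP.
  by apply: measurable_funM => //; exact: measurable_normc2.
- by move=> x _; rewrite mule_ge0// lee_fin ?sqr_ge0.
- apply/measurable_EFinP.
  by apply: measurable_funM => //; exact: measurable_normc2.
Qed.
End closure.
End SquareIntegrable.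

(* The completed Lebesgue measure lives on the Caratheodory sigma-algebra, whose
   elements are the Lebesgue (and not just the Borel) measurable sets. *)
Notation lebT R := (caratheodory_type (@wlength R idfun)^*%mu).
Notation leb R := (@completed_lebesgue_measure R).

Section L2.
Variable R : realType.

Definition Rplus : set (lebT R) := [set x : R | 0 <= x].

Lemma measurable_Rplus : measurable Rplus.
Proof.
apply: sub_caratheodory.
rewrite (_ : Rplus = [set` `[0 : R, +oo[]); last first.
  by apply/seteqP; split => x /=; rewrite in_itv/= andbT.
exact: (@measurable_itv R).
Qed.

(* A function on [0, +oo[ is represented by a function on the whole line whose
   values at negative points are disregarded. *)
Definition L2fun_pred : {pred (lebT R -> R[i]^o)} :=
  fun f => `[< square_integrable (leb R) Rplus f >].

HB.instance Definition _ :=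
  GRing.isSubmodClosed.Build R[i] (lebT R -> R[i]^o) L2fun_pred
    (square_integrable_submod_closed (leb R) measurable_Rplus).

Definition L2fun := {f : lebT R -> R[i]^o | f \in L2fun_pred}.
HB.instance Definition _ := SubChoice.on L2fun.
HB.instance Definition _ := [SubChoice_isSubLmodule of L2fun by <:].

Definition ae_null : {pred L2fun} := fun f =>
  `[< {ae leb R, forall x, Rplus x -> val f x = 0} >].

Lemma ae_null_zmod_closed : zmod_closed ae_null.
Proof.
split; first by apply/asboolP; apply: nearW => x _.
move=> f g /asboolP f0 /asboolP g0; apply/asboolP.
apply: filterS2 f0 g0 => x fx0 gx0 Dx.
by rewrite /= !fctE fx0// gx0// subr0.
Qed.

HB.instance Definition _ := GRing.isZmodClosed.Build L2fun ae_null ae_null_zmod_closed.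

Lemma ae_nullZ a (f : L2fun) : f \in ae_null -> a *: f \in ae_null.
Proof.
move=> /asboolP f0; apply/asboolP; apply: filterS f0 => x fx0 Dx.
by rewrite /= !fctE fx0// scaler0.
Qed.

(* Square integrable functions modulo equality almost everywhere on [0, +oo[ *)
Definition L2 := Quotient.quot ae_null.
HB.instance Definition _ := ZmodQuotient.on L2.
HB.instance Definition _ := Choice.on L2.

Lemma pi_L2P (f g : L2fun) :
  \pi_L2 f = \pi_L2 g <->
  {ae leb R, forall x, Rplus x -> val f x = val g x}.
Proof.
split=> [/eqP|fg].
  rewrite -Quotient.idealrBE => /asboolP; apply: filterS => x h Dx.
  by apply/eqP; rewrite -subr_eq0; apply/eqP; exact: h.
apply/eqP; rewrite -Quotient.idealrBE; apply/asboolP.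
by apply: filterS fg => x h Dx; rewrite /= !fctE h// subrr.
Qed.

Definition L2scale (a : R[i]) (F : L2) : L2 := \pi_L2 (a *: repr F).

Lemma pi_L2scale a (f : L2fun) : L2scale a (\pi_L2 f) = \pi_L2 (a *: f).
Proof.
apply/eqP; rewrite -Quotient.idealrBE -scalerBr; apply: ae_nullZ.
by rewrite Quotient.idealrBE reprK.
Qed.

Fact L2scaleA a b F : L2scale a (L2scale b F) = L2scale (a * b) F.
Proof. by rewrite -[F]reprK !pi_L2scale reprK scalerA. Qed.

Fact L2scale1 : left_id 1 L2scale.
Proof. by move=> F; rewrite -[F]reprK pi_L2scale scale1r. Qed.

Fact L2scaleDr : right_distributive L2scale +%R.
Proof.
move=> a F G; rewrite -[F]reprK -[G]reprK -raddfD !pi_L2scale.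
by rewrite scalerDr raddfD.
Qed.

Fact L2scaleDl F : {morph L2scale^~ F : a b / a + b}.
Proof.
by move=> a b; rewrite -[F]reprK !pi_L2scale scalerDl raddfD.
Qed.

HB.instance Definition _ := GRing.Zmodule_isLmodule.Build R[i] L2
  L2scaleA L2scale1 L2scaleDr L2scaleDl.

Definition L2repr (F : L2) : R -> R[i] := val (repr F).

(* The class of f if f is square integrable on [0, +oo[, and 0 otherwise. *)
Definition L2class (f : R -> R[i]) : L2 := \pi_L2 (insubd 0 f).

Definition L2dot (F G : L2) : R[i] :=
  cintegral (leb R) Rplus (fun x => L2repr F x * (L2repr G x)^*).

(* A^* G is the element H such that <A F, G> = <F, H> for all F: it is unique,
   and exists for all G when A is bounded. The default value 0 is for the
   operators without adjoint. *)
Definition L2adjoint (A : L2 -> L2) (G : L2) : L2 :=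
  xget 0 [set H | forall F, L2dot (A F) G = L2dot F H].

(* The set of all chi_E F, also written chi_E L^2(R_+) *)
Definition chiL2 (E : set R) : set L2 :=
  range (fun F => L2class (fun x => (\1_E x)%:C * L2repr F x)).

(* phi_t; for t >= 0 it vanishes on the negative half-line, so that its
   essential supremum over R is the one over [0, +oo[. *)
Definition symbolt (phi : R -> R) (t x : R) : R :=
  if t <= x then Num.sqrt (phi x / phi (x - t)) else 0.

Definition is_symbol (phi : R -> R) : Prop :=
  [/\ {within [set x : R | 0 <= x], continuous phi},
      forall x, 0 <= x -> 0 < phi x
    & forall t, 0 <= t ->
        (ess_sup (leb R) (fun x => `|symbolt phi t x|%:E) < +oo)%E].

(* S_t; when phi is a symbol, the function below is square integrable (phi_t is
   essentially bounded) and its class does not depend on the representative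
   of F, so L2class does not use its default value. *)
Definition wtsemigroup (phi : R -> R) (t : R) (F : L2) : L2 :=
  L2class (fun x => if t <= x
    then (Num.sqrt (phi x / phi (x - t)))%:C * L2repr F (x - t) else 0).

End L2.

Definition ker (U V : zmodType) (A : U -> V) : set U := A @^-1` [set 0].

(* Meant for linear subspaces W of V: no finite family of elements of W spans W. *)
Definition infinite_dimensional (K : fieldType) (V : lmodType K) (W : set V) :=
  ~ exists (n : nat) (b : 'I_n -> V), (forall i, W (b i)) /\
      forall w, W w -> exists c : 'I_n -> K, w = \sum_(i < n) c i *: b i.

(* Main.v *)
(* The adjoint of S_t is explicit: translation invariance of Lebesgue measure
   gives (S_t^* G)(y) = sqrt(phi(y + t) / phi(y)) G(y + t), and the essential
   boundedness of phi_t makes the right-hand side square integrable. The weight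
   never vanishes, so S_t^* G = 0 exactly when G vanishes almost everywhere on
   [t, +oo[. Cutting [0, t[ into n intervals of equal length gives n linearly
   independent characteristic functions in this space, for every n. *)
Require Import Defs.
From HB Require Import structures.
From mathcomp Require Import all_boot all_order all_algebra.
From mathcomp Require Import complex.
From mathcomp Require Import all_classical all_reals all_analysis.
From mathcomp Require Import measurable_realfun ess_sup_inf ring.
Import Order.TTheory GRing.Theory Num.Theory.
Import numFieldNormedType.Exports.
Local Open Scope classical_set_scope.
Local Open Scope ring_scope.
Set Implicit Arguments.
Unset Strict Implicit.
Unset Printing Implicit Defensive.

Local Notation Re := complex.Re.
Local Notation Im := complex.Im.
Local Notation normc := ComplexField.Normc.normc.

(** * Translation invariance of the completed Lebesgue measure *)

Section LebesgueShift.
Context {R : realType}.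
Local Open Scope ereal_scope.

Let shift (s : R) : R -> R := fun x => (x + s)%R.

Lemma ocitv_shift s (A : set R) : ocitv A -> ocitv (shift s @^-1` A).
Proof.
move=> [[a b] _ <-]; exists (a - s, b - s)%R => //.
by apply/seteqP; split=> x /=; rewrite !in_itv/= ltrBlDr lerBrDr.
Qed.

Lemma wlength_shift s (A : set R) : ocitv A ->
  wlength idfun (shift s @^-1` A) = wlength idfun A.
Proof.
move=> [[a b] _ <-].
rewrite (_ : _ @^-1` _ = `](a - s), (b - s)]%classic)%R; last first.
  by apply/seteqP; split=> x /=; rewrite !in_itv/= ltrBlDr lerBrDr.
rewrite !wlength_itv/= !lte_fin ltrD2r; case: ifP => // _.
by rewrite -!EFinB opprB addrA subrK.
Qed.

(** Translating a countable cover by half-open intervals keeps its total length, which gives one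
    inequality for every translation. The opposite translation gives the reverse one. *)
Lemma mu_ext_shift s (A : set R) :
  mu_ext (wlength idfun) (shift s @^-1` A : set (ocitv_type R)) =
  mu_ext (wlength idfun) (A : set (ocitv_type R)).
Proof.
have H r (B : set R) :
    mu_ext (wlength idfun) (shift r @^-1` B : set (ocitv_type R)) <=
    mu_ext (wlength idfun) (B : set (ocitv_type R)).
  apply/ereal_infP => _ [F [mF BF] <-]; apply: ereal_inf_lbound.
  exists (fun k => shift r @^-1` F k).
    split; first by move=> k; exact: (ocitv_shift r (mF k)).
    by rewrite -preimage_bigcup; exact: preimage_subset.
  by apply: eq_eseriesr => k _; exact: (wlength_shift _ (mF k)).
apply/eqP; rewrite eq_le H/=.
rewrite [X in mu_ext _ X <= _](_ : _ = shift (- s)%R @^-1` (shift s @^-1` A)).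
  exact: H.
by apply/seteqP; split=> x /=; rewrite /shift subrK.
Qed.

(** The sets to pull back are Lebesgue measurable, not only Borel, so continuity does not suffice.
    The Caratheodory criterion is inherited from the invariance of the outer measure. *)
Lemma measurable_shift s :
  measurable_fun setT (shift s : lebT R -> lebT R).
Proof.
move=> _ A mA; rewrite setTI.
have {}mA : caratheodory_measurable (mu_ext (wlength idfun))
    (A : set (ocitv_type R)).
  exact: mA.
suff : caratheodory_measurable (mu_ext (wlength idfun))
  (shift s @^-1` A : set (ocitv_type R)) by [].
(* The test set [X] is translated to the position of [A], cut by [A], and both pieces are translated
   back. *)
move=> X; rewrite -[LHS](mu_ext_shift (- s)) mA.
rewrite -(mu_ext_shift s (_ `&` A)) -(mu_ext_shift s (_ `&` ~` A)).
have E (C : set R) :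
    shift s @^-1` (shift (- s) @^-1` X `&` C) = X `&` shift s @^-1` C.
  by apply/seteqP; split => x; rewrite /preimage /shift /= addrK.
by rewrite !E.
Qed.

Lemma leb_shift s (A : set (lebT R)) : leb R (shift s @^-1` A) = leb R A.
Proof. exact: mu_ext_shift. Qed.

Lemma ae_shift s (P : lebT R -> Prop) :
  {ae leb R, forall x, P x} -> {ae leb R, forall x : lebT R, P (x + s)%R}.
Proof.
move=> [A [mA A0 PA]]; exists (shift s @^-1` A); split.
- by rewrite -[X in measurable X]setTI; exact: measurable_shift.
- by rewrite leb_shift.
- by move=> x; exact: PA.
Qed.

(** By [leb_shift], the pushforward of Lebesgue measure under the translation is Lebesgue measure
    itself. *)
Lemma ge0_integral_shift s (D : set (lebT R)) (f : lebT R -> \bar R) :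
  measurable D -> measurable_fun D f -> (forall x, D x -> 0 <= f x) ->
  \int[leb R]_(x in D) f x =
  \int[leb R]_(x in (fun x => x + s)%R @^-1` D) f (x + s)%R.
Proof.
move=> mD mf f0.
rewrite -[RHS](ge0_integral_pushforward (measurable_shift s))//; last first.
  by move=> x /set_mem; exact: f0.
apply: eq_measure_integral => [|mS A mA _]; first exact: measurable_shift.
exact/esym/leb_shift.
Qed.

Lemma integral_shift s (D : set (lebT R)) (f : lebT R -> \bar R) :
  measurable D -> measurable_fun D f ->
  \int[leb R]_(x in D) f x =
  \int[leb R]_(x in (fun x => x + s)%R @^-1` D) f (x + s)%R.
Proof.
move=> mD mf; rewrite [LHS]integralE [RHS]integralE.
congr (_ - _).
  rewrite (ge0_integral_shift s)//; last exact: measurable_funepos.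
  by apply: eq_integral => x _; rewrite !funeposE.
rewrite (ge0_integral_shift s)//; last exact: measurable_funeneg.
by apply: eq_integral => x _; rewrite !funenegE.
Qed.

End LebesgueShift.

(** * Square integrable functions and the inner product *)

Section ComplexMeasurable.
Context d (T : measurableType d) (R : realType).
Local Open Scope complex_scope.

Lemma cmeasurable_funM_conj (D : set T) (f g : T -> R[i]^o) :
  cmeasurable_fun D f -> cmeasurable_fun D g ->
  cmeasurable_fun D (fun x => (f x : R[i]) * (g x)^*).
Proof.
move=> [fr fi] [gr gi]; split.
  rewrite (_ : (fun _ => _) =
      (fun x => Re (f x) * Re (g x) + Im (f x) * Im (g x))).
    by apply: measurable_funD => //; exact: measurable_funM.
  by apply/funext => x; case: (f x) (g x) => a b [c e] /=; rewrite mulrN opprK.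
rewrite (_ : (fun _ => _) =
    (fun x => Im (f x) * Re (g x) - Re (f x) * Im (g x))).
  by apply: measurable_funB => //; exact: measurable_funM.
by apply/funext => x; case: (f x) (g x) => a b [c e] /=; rewrite mulrN addrC.
Qed.

Lemma cmeasurable_funZ (D : set T) (w : T -> R) (f : T -> R[i]^o) :
  measurable_fun D w -> cmeasurable_fun D f ->
  cmeasurable_fun D (fun x => (w x)%:C * (f x : R[i])).
Proof.
move=> mw [fr fi]; split.
  rewrite (_ : (fun _ => _) = (fun x => w x * Re (f x))).
    exact: measurable_funM.
  by apply/funext => x; case: (f x) => a b /=; rewrite mul0r subr0.
rewrite (_ : (fun _ => _) = (fun x => w x * Im (f x))).
  exact: measurable_funM.
by apply/funext => x; case: (f x) => a b /=; rewrite mul0r addr0.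
Qed.

Lemma cintegral_ae_eq (mu : {measure set T -> \bar R}) (D : set T)
    (f g : T -> R[i]^o) :
  measurable D -> cmeasurable_fun D f -> cmeasurable_fun D g ->
  {ae mu, forall x, D x -> f x = g x} ->
  cintegral (mu) D f = cintegral (mu) D g.
Proof.
move=> mD [fr fi] [gr gi] fg; rewrite /cintegral /Rintegral.
congr (fine _ +i* fine _); apply: ae_eq_integral => //;
  try exact/measurable_EFinP.
- by apply: filterS fg => x /[apply] ->.
- by apply: filterS fg => x /[apply] ->.
Qed.

Lemma cmeasurable_funS (E D : set T) (h : T -> R[i]^o) :
  measurable E -> D `<=` E -> cmeasurable_fun E h -> cmeasurable_fun D h.
Proof. by move=> mE DE [hr hi]; split; exact: measurable_funS DE _. Qed.

(** Integrates [|w h|^2 <= M^2 |h|^2], so an almost everywhere bound is enough. It serves both the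
    weight of the semigroup and indicator functions. *)
Lemma square_integrableZ (mu : {measure set T -> \bar R}) (D : set T)
    (w : T -> R) (M : R) (h : T -> R[i]^o) :
  measurable D -> measurable_fun D w -> {ae mu, forall x, D x -> `|w x| <= M} ->
  square_integrable mu D h ->
  square_integrable mu D (fun x => (w x)%:C * (h x : R[i])).
Proof.
move=> mD mw wM [mh inth]; split; first exact: cmeasurable_funZ.
apply: (@le_lt_trans _ _
  (\int[mu]_(x in D) ((M ^+ 2)%:E * (normc (h x) ^+ 2)%:E)))%E.
  apply: ae_ge0_le_integral => //.
  - by move=> x _; rewrite lee_fin sqr_ge0.
  - apply/measurable_EFinP; apply: measurable_normc2 => //.
    exact: cmeasurable_funZ.
  - by move=> x _; rewrite mule_ge0 ?lee_fin ?sqr_ge0.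
  - apply/measurable_EFinP; apply: measurable_funM => //.
    exact: measurable_normc2.
  - apply: filterS wM => x /[apply] wM.
    rewrite -EFinM lee_fin (_ : normc _ ^+ 2 = w x ^+ 2 * normc (h x) ^+ 2).
      rewrite ler_wpM2r ?sqr_ge0// -real_normK ?num_real//.
      (* The sign of [M] comes from [0 <= |w x| <= M]. *)
      by rewrite ler_sqr ?nnegrE//; exact: le_trans wM.
    by rewrite !normcE2; case: (h x) => a b /=; ring.
rewrite ge0_integralZl_EFin ?sqr_ge0//.
- by rewrite lte_mul_pinfty// lee_fin sqr_ge0.
- by move=> x _; rewrite lee_fin sqr_ge0.
- by apply/measurable_EFinP; exact: measurable_normc2.
Qed.

End ComplexMeasurable.

Section L2Theory.
Context {R : realType}.
Local Open Scope complex_scope.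
Local Notation Rplus := (@Rplus R).
Local Notation si := (square_integrable (leb R) Rplus).
Implicit Types (f g : R -> R[i]) (F G : L2 R).

Lemma L2repr_square_integrable F : si (L2repr F).
Proof. by have /asboolP := valP (repr F). Qed.

Lemma eq_L2P F G :
  F = G <-> {ae leb R, forall x, Rplus x -> L2repr F x = L2repr G x}.
Proof. by rewrite -[X in X = _]reprK -[X in _ = X]reprK; exact: pi_L2P. Qed.

(** Square integrability makes [insubd] return [f] rather than its default 0. The representative
    chosen in the class may still differ from [f] on a null set. *)
Lemma L2repr_class f : si f ->
  {ae leb R, forall x, Rplus x -> L2repr (L2class f) x = f x}.
Proof.
move=> sf.
have : \pi_(L2 R)%qT (repr (L2class f)) =
    \pi_(L2 R)%qT (insubd 0 (f : lebT R -> R[i]^o)).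
  by rewrite reprK.
by move/pi_L2P; rewrite insubdK//; exact/asboolP.
Qed.

Lemma L2repr0 : {ae leb R, forall x, Rplus x -> L2repr (0 : L2 R) x = 0}.
Proof.
have : \pi_(L2 R)%qT (repr (0 : L2 R)) = \pi_(L2 R)%qT 0.
  by rewrite reprK raddf0.
by move/pi_L2P; apply: filterS => x h Dx; exact: h.
Qed.

Lemma eq_L2_0P F :
  F = 0 <-> {ae leb R, forall x, Rplus x -> L2repr F x = 0}.
Proof.
rewrite eq_L2P; split; apply: filterS2 L2repr0 => x F0 h Dx.
  by rewrite h// F0.
by rewrite h// F0.
Qed.

Lemma cmeasurable_L2repr F :
  cmeasurable_fun Rplus (L2repr F : lebT R -> R[i]^o).
Proof. by have [] := L2repr_square_integrable F. Qed.

Lemma L2dotr0 F : L2dot F 0 = 0.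
Proof.
transitivity (cintegral (leb R) Rplus (fun=> 0)).
  apply: cintegral_ae_eq.
  - exact: measurable_Rplus.
  - apply: cmeasurable_funM_conj; exact: cmeasurable_L2repr.
  - by split; exact: measurable_cst.
  - by apply: filterS L2repr0 => x /[apply] ->; rewrite rmorph0 mulr0.
by rewrite /cintegral /Rintegral /= !integral0.
Qed.

Lemma L2dot_eq0 F : L2dot F F = 0 -> F = 0.
Proof.
have [mF intF] := L2repr_square_integrable F.
move=> FF0.
have int0 : fine (\int[leb R]_(x in Rplus) (normc (L2repr F x) ^+ 2)%:E) = 0.
  rewrite -[RHS](congr1 (fun z => Re z) FF0); congr fine.
  apply: eq_integral => x _; congr EFin; rewrite normcE2.
  by case: (L2repr F x) => a b /=; rewrite mulrN opprK.
have ae0 :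
    ae_eq (leb R) Rplus (fun x => (normc (L2repr F x) ^+ 2)%:E) (cst 0%E).
  apply/ae_eq_integral_abs; first exact: measurable_Rplus.
    by apply/measurable_EFinP; exact: measurable_normc2.
  under eq_integral do rewrite gee0_abs ?lee_fin ?sqr_ge0//.
  (* [fine] also sends infinite values to 0. Here [intF] excludes [+oo] and positivity excludes
     [-oo], so the extended integral itself is 0. *)
  move: int0 intF.
  have : (0 <= \int[leb R]_(x in Rplus) (normc (L2repr F x) ^+ 2)%:E)%E.
    by apply: integral_ge0 => x _; rewrite lee_fin sqr_ge0.
  by case: integral => //= r _ ->.
apply/eq_L2_0P; apply: filterS ae0 => x /[apply] /eqP.
rewrite eqe expf_eq0/= => /eqP; exact: ComplexField.Normc.eq0_normc.
Qed.

(** Definiteness of the inner product settles both directions. If the adjoint is 0 at [G], testing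
    at [F = A' G] gives [<A' G, A' G> = 0]. If [A' G = 0], then 0 satisfies the adjoint relation,
    and any other solution [H], tested against itself, is 0. *)
Lemma L2adjointP (A : L2 R -> L2 R) (A' : L2 R -> L2 R) G :
  (forall F, L2dot (A F) G = L2dot F (A' G)) ->
  L2adjoint A G = 0 <-> A' G = 0.
Proof.
move=> AA'; split => [A0|A'G0].
  apply: L2dot_eq0; rewrite -AA'.
  have /(@xgetPex _ 0) :
    exists H, [set H | forall F, L2dot (A F) G = L2dot F H] H.
    by exists (A' G).
  by rewrite -/(L2adjoint A G) A0 => /(_ (A' G)) ->; exact: L2dotr0.
apply: xget_unique => /=.
  by move=> F; rewrite AA' A'G0.
by move=> H HP; apply: L2dot_eq0; rewrite -HP AA' A'G0 L2dotr0.
Qed.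

End L2Theory.

(** * Translations of functions on the half-line *)

Section ShiftedFunctions.
Context {R : realType}.
Local Open Scope complex_scope.
Local Notation Rplus := (@Rplus R).
Local Notation si := (square_integrable (leb R) Rplus).

Lemma measurable_fun_shift d (T : measurableType d) s (D : set (lebT R))
    (h : lebT R -> T) :
  measurable D -> measurable_fun D h ->
  measurable_fun ((fun x : lebT R => x + s) @^-1` D)
    (fun x : lebT R => h (x + s)).
Proof.
move=> mD mh; apply: (measurable_comp mD _ mh).
  exact: image_preimage_subset.
by apply: measurable_funTS; exact: measurable_shift.
Qed.

Lemma measurable_preimage_shift s (D : set (lebT R)) :
  measurable D -> measurable ((fun x : lebT R => x + s) @^-1` D).
Proof.
by move=> mD; rewrite -[X in measurable X]setTI; exact: measurable_shift.
Qed.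

Lemma cmeasurable_fun_shift s (D : set (lebT R)) (h : lebT R -> R[i]^o) :
  measurable D -> cmeasurable_fun D h ->
  cmeasurable_fun ((fun x : lebT R => x + s) @^-1` D)
    (fun x : lebT R => h (x + s)).
Proof.
by move=> mD [hr hi]; split; [exact: (measurable_fun_shift mD hr)|
  exact: (measurable_fun_shift mD hi)].
Qed.

Lemma cintegral_shift s (D : set (lebT R)) (h : lebT R -> R[i]^o) :
  measurable D -> cmeasurable_fun D h ->
  cintegral (leb R) D h =
  cintegral (leb R) ((fun x => x + s) @^-1` D) (fun x => h (x + s)).
Proof.
move=> mD [hr hi]; congr (fine _ +i* fine _).
  by apply: (integral_shift s mD); exact/measurable_EFinP.
by apply: (integral_shift s mD); exact/measurable_EFinP.
Qed.

Lemma preimage_shift_Rplus s :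
  0 <= s -> Rplus `<=` (fun x => x + s) @^-1` Rplus.
Proof. by move=> s0 x /= x0; exact: addr_ge0. Qed.

(** Translation preserves the integral only over [[-s, +oo[]. Restricting to the half-line drops the
    part of [h] on [[0, s[], so the integral can only decrease. *)
Lemma square_integrable_shift s (h : R -> R[i]) : 0 <= s -> si h ->
  si (fun x => h (x + s)).
Proof.
move=> s0 [mh intf].
have mp := @measurable_Rplus R.
have mps := measurable_preimage_shift s mp.
split.
  apply: cmeasurable_funS (cmeasurable_fun_shift s mp mh) => //.
  exact: preimage_shift_Rplus.
apply: le_lt_trans intf.
rewrite [leRHS](ge0_integral_shift s mp); last 2 first.
- by apply/measurable_EFinP; exact: (measurable_normc2 mh).
- by move=> x _; rewrite lee_fin sqr_ge0.
apply: (ge0_subset_integral _ mp mps).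
- apply/measurable_EFinP; apply: measurable_normc2.
  exact: (cmeasurable_fun_shift s mp mh).
- by move=> x _; rewrite lee_fin sqr_ge0.
- exact: preimage_shift_Rplus.
Qed.

Definition right_shift (t : R) (h : R -> R[i]) (x : R) : R[i] :=
  if t <= x then h (x - t) else 0.

Lemma preimage_shiftN_Rplus t x :
  ((fun x : R => x - t) @^-1` Rplus) x = (t <= x).
Proof. by rewrite /preimage/= /Defs.Rplus/= subr_ge0. Qed.

(** Turns a definition by cases into a restriction to [[t, +oo[], written as a translate of the
    half-line. The type [V] covers real functions, for measurability, and extended real ones, for
    integrals. *)
Lemma right_shift_patch V (v : V) t (k : R -> V) x : 0 <= t ->
  Rplus x -> (if t <= x then k x else v) =
  (if x \in (fun x : R => x - t) @^-1` Rplus then k x else v).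
Proof.
move=> t0 x0; rewrite (_ : (x \in _) = (t <= x))//.
by apply/idP/idP => [/set_mem|h]; [|apply/mem_set];
  rewrite preimage_shiftN_Rplus.
Qed.

Lemma preimage_shiftN_subset t : 0 <= t ->
  (fun x : R => x - t) @^-1` Rplus `<=` Rplus.
Proof. by move=> t0 x; rewrite preimage_shiftN_Rplus; exact: le_trans. Qed.

Lemma integral_right_shift t (k : R -> \bar R) : 0 <= t ->
  (\int[leb R]_(x in Rplus) (if (t <= x)%R then k x else 0) =
   \int[leb R]_(x in (fun x => x - t)%R @^-1` Rplus) k x)%E.
Proof.
move=> t0.
have -> : (fun x => x - t) @^-1` Rplus =
    Rplus `&` ((fun x => x - t) @^-1` Rplus).
  by rewrite setIidr//; exact: preimage_shiftN_subset.
rewrite integral_mkcondr; apply: eq_integral => x /set_mem x0.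
by rewrite patchE; exact: right_shift_patch.
Qed.

Lemma measurable_right_shift t (k : lebT R -> R) : 0 <= t ->
  measurable_fun ((fun x : lebT R => x - t) @^-1` Rplus) k ->
  measurable_fun Rplus (fun x : lebT R => if t <= x then k x else 0).
Proof.
move=> t0 mk.
have mE := measurable_preimage_shift (- t) (@measurable_Rplus R).
have := (measurable_restrictT k mE).1 mk => /measurable_funTS mk'.
apply: eq_measurable_fun (mk' Rplus) => x /set_mem x0.
rewrite patchE; exact/esym/right_shift_patch.
Qed.

Lemma square_integrable_right_shift t (h : R -> R[i]) : 0 <= t -> si h ->
  si (right_shift t h).
Proof.
move=> t0 [mh intf].
have mp := @measurable_Rplus R.
have [mhr mhi] := cmeasurable_fun_shift (- t) mp mh.
(* Used with [k] the real part, the imaginary part and the squared modulus, each of which is 0 at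
   0. *)
have E V (k : R[i] -> V) (x : R) :
    k (right_shift t h x) = if t <= x then k (h (x - t)) else k 0.
  by rewrite /right_shift; case: ifP.
split.
  split.
    by under eq_fun do rewrite E; exact: measurable_right_shift.
  by under eq_fun do rewrite E; exact: measurable_right_shift.
have n0 : normc (0 : R[i]) ^+ 2 = 0 by rewrite normcE2/= expr0n addr0.
under eq_integral do rewrite (E _ (fun z => (normc z ^+ 2)%:E)) n0.
rewrite integral_right_shift//.
rewrite [X in (X < _)%E](_ : _ =
  \int[leb R]_(x in Rplus) (normc (h x) ^+ 2)%:E)%E //.
apply/esym/(ge0_integral_shift (- t) mp).
- by apply/measurable_EFinP; exact: (measurable_normc2 mh).
- by move=> x _; rewrite lee_fin sqr_ge0.
Qed.

Lemma cintegral_right_shift t (k : R -> R[i]) : 0 <= t ->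
  cintegral (leb R) Rplus (fun x => if t <= x then k x else 0) =
  cintegral (leb R) ((fun x => x - t) @^-1` Rplus) k.
Proof.
move=> t0; congr (fine _ +i* fine _).
  by rewrite -integral_right_shift//; apply: eq_integral => x _; case: ifP.
by rewrite -integral_right_shift//; apply: eq_integral => x _; case: ifP.
Qed.

End ShiftedFunctions.

(** * The adjoint of the weighted translation *)

Section Adjoint.
Context {R : realType}.
Local Open Scope complex_scope.
Local Notation Rplus := (@Rplus R).
Local Notation si := (square_integrable (leb R) Rplus).

Variables (phi : R -> R) (t : R).
Hypotheses (hphi : is_symbol phi) (t0 : 0 <= t).

(** This is [phi_t] at [y + t]. With this parametrization [S_t] multiplies by [weight] and then
    translates to the right, while its adjoint translates to the left and then multiplies by the
    same [weight]. *)
Definition weight (y : R) : R := Num.sqrt (phi (y + t) / phi y).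

Lemma weight_gt0 y : 0 <= y -> 0 < weight y.
Proof.
move=> y0; have [_ phi0 _] := hphi.
by rewrite sqrtr_gt0 divr_gt0// phi0// addr_ge0.
Qed.

(** The essential bound of [phi_t] carries over because translations preserve null sets. *)
Lemma weight_bounded :
  exists M : R, {ae leb R, forall x, Rplus x -> `|weight x| <= M}.
Proof.
have [_ _ /(_ _ t0) /ess_supr_bounded[M hM]] := hphi.
exists M; have := ae_shift t hM; apply: filterS => x + x0.
by rewrite /symbolt lerDr x0 addrK.
Qed.

Lemma measurable_weight : measurable_fun Rplus (weight : lebT R -> R).
Proof.
have [cphi phi0 _] := hphi.
have mR : measurable ([set x : R | 0 <= x] : set R).
  rewrite (_ : [set _ | _] = [set` `[0 : R, +oo[]); first exact: measurable_itv.
  by apply/seteqP; split => x /=; rewrite in_itv/= andbT.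
(* Continuity on the half-line gives Borel measurability there, and Borel sets are Lebesgue
   measurable. *)
have cara (f : R -> R) : {within [set x : R | 0 <= x], continuous f} ->
    measurable_fun Rplus (f : lebT R -> R).
  move=> cf _ Y mY; apply: sub_caratheodory.
  exact: (subspace_continuous_measurable_fun mR cf mR mY).
have mphi := cara _ cphi.
have mphiV : measurable_fun Rplus (fun x : lebT R => (phi x)^-1).
  apply: cara; apply/subspace_continuousP => x x0; apply: cvgV.
    by rewrite gt_eqF//; exact: phi0.
  exact: (subspace_continuousP _ _).1 cphi x x0.
have msqrt : measurable_fun [set: R] (@Num.sqrt R).
  by apply: continuous_measurable_fun; exact: sqrt_continuous.
apply: (measurableT_comp msqrt).
apply: (measurable_funM _ mphiV).
have mp := @measurable_Rplus R.
apply: measurable_funS (measurable_fun_shift mp mphi).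
  exact: (measurable_preimage_shift t mp).
exact: preimage_shift_Rplus.
Qed.

Lemma square_integrable_weight (h : R -> R[i]) : si h ->
  si (fun x => (weight x)%:C * h x).
Proof.
have [M hM] := weight_bounded.
exact: (square_integrableZ (@measurable_Rplus R) measurable_weight hM).
Qed.

(** The candidate for the adjoint, read off from [<S_t F, G>] after substituting [x = y + t]. *)
Definition left_wtshift (G : L2 R) : L2 R :=
  L2class (fun y => (weight y)%:C * L2repr G (y + t)).

Lemma wtsemigroup_right_shift (F : L2 R) :
  wtsemigroup phi t F =
  L2class (right_shift t (fun y => (weight y)%:C * L2repr F y)).
Proof.
rewrite /wtsemigroup; congr L2class; apply/funext => x.
by rewrite /right_shift /weight subrK.
Qed.

Lemma L2repr_wtsemigroup F : {ae leb R, forall x, Rplus x ->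
  L2repr (wtsemigroup phi t F) x =
  right_shift t (fun y => (weight y)%:C * L2repr F y) x}.
Proof.
rewrite wtsemigroup_right_shift; apply: L2repr_class.
apply: (square_integrable_right_shift t0); apply: square_integrable_weight.
exact: L2repr_square_integrable.
Qed.

Lemma square_integrable_left_wtshift (G : L2 R) :
  si (fun y => (weight y)%:C * L2repr G (y + t)).
Proof.
apply: square_integrable_weight; apply: (square_integrable_shift t0).
exact: L2repr_square_integrable.
Qed.

Lemma L2repr_left_wtshift G : {ae leb R, forall x, Rplus x ->
  L2repr (left_wtshift G) x = (weight x)%:C * L2repr G (x + t)}.
Proof. exact/L2repr_class/square_integrable_left_wtshift. Qed.

Lemma wtsemigroup_adjoint F G :
  L2dot (wtsemigroup phi t F) G = L2dot F (left_wtshift G).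
Proof.
have mp := @measurable_Rplus R.
pose h y := (weight y)%:C * L2repr F y.
have sh : si h.
  by apply: square_integrable_weight; exact: L2repr_square_integrable.
have [mrh _] := square_integrable_right_shift t0 sh.
have mE := measurable_preimage_shift (- t) mp.
transitivity (cintegral (leb R) Rplus
    (fun x => right_shift t h x * (L2repr G x)^*)).
  apply: (cintegral_ae_eq mp).
  - by apply: cmeasurable_funM_conj; exact: cmeasurable_L2repr.
  - by apply: (cmeasurable_funM_conj mrh); exact: cmeasurable_L2repr.
  - by apply: filterS (L2repr_wtsemigroup F) => x /[apply] ->.
transitivity (cintegral (leb R) Rplus
    (fun x => if t <= x then h (x - t) * (L2repr G x)^* else 0)).
  congr (cintegral _ _ _); apply/funext => x; rewrite /right_shift.
  by case: ifP => // _; rewrite mul0r.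
(* The integrand vanishes below [t]. The integral is cut down to [[t, +oo[] and then moved by [t],
   which brings the domain back to the half-line. *)
rewrite cintegral_right_shift// (cintegral_shift t mE); last first.
  apply: cmeasurable_funM_conj.
    exact: (cmeasurable_fun_shift (- t) mp sh.1).
  apply: (cmeasurable_funS mp _ (cmeasurable_L2repr G)).
  exact: preimage_shiftN_subset.
rewrite [X in cintegral _ X _](_ : _ = Rplus); last first.
  by apply/seteqP; split => x; rewrite /preimage/= addrK.
apply: esym; apply: (cintegral_ae_eq mp).
- by apply: cmeasurable_funM_conj; exact: cmeasurable_L2repr.
- under eq_fun do rewrite addrK.
  apply: cmeasurable_funM_conj; first exact: sh.1.
  apply: (cmeasurable_funS (measurable_preimage_shift t mp) _
    (cmeasurable_fun_shift t mp (cmeasurable_L2repr G))).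
  exact: preimage_shift_Rplus.
- apply: filterS (L2repr_left_wtshift G) => x /[apply] ->.
  (* The weight is real, so conjugation fixes it and it can pass from one factor to the other. *)
  rewrite addrK /h; case: (L2repr F x) (L2repr G _) => a b [c d] /=.
  by apply/eqP; rewrite eq_complex /=; apply/andP; split; apply/eqP; ring.
Qed.

Lemma ker_wtsemigroup_adjointP G :
  ker (L2adjoint (wtsemigroup phi t)) G <->
  {ae leb R, forall x : lebT R, t <= x -> L2repr G x = 0}.
Proof.
rewrite /ker /preimage /=.
rewrite (L2adjointP (A' := left_wtshift)); last first.
  by move=> F; exact: wtsemigroup_adjoint.
rewrite eq_L2_0P; split=> [h|h].
  have h' : {ae leb R, forall x, Rplus x -> L2repr G (x + t) = 0}.
    apply: filterS2 (L2repr_left_wtshift G) h => x + + x0.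
    move=> /(_ x0) -> /(_ x0) /eqP.
    rewrite mulf_eq0 => /orP[|/eqP//].
    by rewrite eq_complex/= gt_eqF// weight_gt0.
  (* The translation carries the half-line onto [[t, +oo[] and the exceptional null set onto a null
     set. *)
  have := ae_shift (- t) h'; apply: filterS => x + tx.
  by rewrite subrK; apply; rewrite /Defs.Rplus/= subr_ge0.
have := ae_shift t h.
apply: filterS2 (L2repr_left_wtshift G) => x + hx x0.
move=> /(_ x0) ->; rewrite hx ?mulr0//.
by rewrite lerDr.
Qed.

End Adjoint.

(** * Dimension *)

(** Expressing [n + 1] independent vectors of [W] in a spanning family of size [n] gives a matrix
    with more rows than columns. A nonzero row vector in its left kernel would be a nontrivial
    relation between these vectors. *)
Lemma infinite_dimensional_free (K : fieldType) (V : lmodType K) (W : set V) :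
  (forall n, exists u : 'I_n -> V, (forall i, W (u i)) /\
    forall c : 'I_n -> K, \sum_(i < n) c i *: u i = 0 -> forall i, c i = 0) ->
  infinite_dimensional W.
Proof.
move=> free [n [b [_ span]]]; have [u [Wu indep]] := free n.+1.
have /choice[c uE] :
    forall k, exists c : 'I_n -> K, u k = \sum_(i < n) c i *: b i.
  by move=> k; exact/span/Wu.
pose M := \matrix_(k, i) c k i.
have kerM0 : kermx M != 0.
  by rewrite -mxrank_eq0 mxrank_ker subn_eq0 -ltnNge ltnS rank_leq_col.
pose v := nz_row (kermx M).
have /sub_kermxP vM : (v <= kermx M)%MS by exact: nz_row_sub.
have v0 : v != 0 by rewrite nz_row_eq0.
suff : v = 0 by apply/eqP.
apply/rowP => k; rewrite mxE; move: k; apply: indep.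
under eq_bigr do rewrite uE scaler_sumr.
rewrite exchange_big/= big1// => i _.
under eq_bigr do rewrite scalerA.
rewrite -scaler_suml; have /rowP/(_ i) := vM; rewrite !mxE.
by under eq_bigr do rewrite mxE; move=> ->; rewrite scale0r.
Qed.

(** * Functions supported in a set, and independent indicator functions *)

Section Characteristic.
Context {R : realType}.
Local Open Scope complex_scope.
Local Notation Rplus := (@Rplus R).
Local Notation si := (square_integrable (leb R) Rplus).

(** A class vanishing almost everywhere off [E] is its own product with the indicator of [E], so [G]
    itself serves as the preimage. *)
Lemma chiL2P (E : set (lebT R)) (G : L2 R) : measurable E ->
  chiL2 E G <-> {ae leb R, forall x, Rplus x -> ~ E x -> L2repr G x = 0}.
Proof.
move=> mE.
have sE (F : L2 R) : si (fun x => (\1_E x)%:C * L2repr F x).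
  apply: (square_integrableZ (@measurable_Rplus R) (M := 1)).
  - exact: measurable_indic.
  - apply: nearW => x _; rewrite indicE.
    by case: (x \in E); rewrite ?normr1 ?normr0.
  - exact: L2repr_square_integrable.
split=> [[F _ <-]|G0].
  have := L2repr_class (sE F); apply: filterS => x + x0 nEx.
  by move=> /(_ x0) ->; rewrite indicE memNset// mul0r.
exists G => //; apply/eq_L2P.
apply: filterS2 (L2repr_class (sE G)) G0 => x + + x0.
move=> /(_ x0) -> /(_ x0); rewrite indicE.
case: (boolP (x \in E)) => [_ _|/negP nEx ->]; first by rewrite mul1r.
  by rewrite mulr0.
by move=> Ex; apply: nEx; exact/mem_set.
Qed.

Lemma measurable_itvco (a b : R) :
  measurable ([set x : R | a <= x < b] : set (lebT R)).
Proof.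
apply: sub_caratheodory; rewrite (_ : [set _ | _] = [set` `[a, b[]).
  exact: (@measurable_itv R).
by apply/seteqP; split => x /=; rewrite in_itv.
Qed.

Lemma leb_itvco (a b : R) : a <= b ->
  leb R ([set x : R | a <= x < b] : set (lebT R)) = (b - a)%:E.
Proof.
move=> ab; transitivity (lebesgue_measure [set` `[a, b[]).
  (* Both measures restrict the same outer measure. *)
  by congr (mu_ext _ _); apply/seteqP; split => x /=; rewrite in_itv.
rewrite lebesgue_measure_itv/= lte_fin; case: ltP => // ba.
by rewrite (@le_anti _ _ a b) ?ab// subrr.
Qed.

(** A set of positive measure does not fit in a null set. This allows an almost everywhere identity
    to be evaluated at a point of [B]. *)
Lemma ae_witness (B : set (lebT R)) (P : lebT R -> Prop) :
  measurable B -> (0 < leb R B)%E -> {ae leb R, forall x, P x} ->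
  exists2 x, B x & P x.
Proof.
move=> mB B0 [A [mA A0 PA]]; apply: contrapT => nex.
move: B0; rewrite ltNge => /negP; apply; rewrite -A0.
apply: le_measure; rewrite ?inE//.
move=> x Bx; apply: PA => Px; apply: nex.
by exists x.
Qed.

Lemma square_integrable_indic (E : set (lebT R)) :
  measurable E -> (leb R E < +oo)%E -> si (fun x => (\1_E x)%:C).
Proof.
move=> mE Eoo; split.
  by split; [exact: measurable_indic|exact: measurable_cst].
have -> : (fun x : lebT R => (normc ((\1_E x)%:C : R[i]) ^+ 2)%:E) =
    (fun x : lebT R => (\1_E x)%:E).
  apply/funext => x; rewrite normcE2/= expr0n addr0 indicE.
  by case: (x \in E); rewrite ?expr1n ?expr0n.
rewrite (integral_indic _ (@measurable_Rplus R) mE).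
apply: le_lt_trans Eoo; apply: le_measure; rewrite ?inE//.
exact: (measurableI _ _ mE (@measurable_Rplus R)).
Qed.

Lemma L2_free_subintervals (t : R) n : 0 < t -> exists u : 'I_n -> L2 R,
  (forall i, {ae leb R, forall x : lebT R, t <= x -> L2repr (u i) x = 0}) /\
  forall c : 'I_n -> R[i], \sum_(i < n) c i *: u i = 0 -> forall i, c i = 0.
Proof.
move=> t0.
case: n => [|n]; first by exists (fun=> 0); split => [[]//|c _ []].
(* After the case split the family has [n + 1] members, so the last interval ends exactly at [t]. *)
pose d := t / n.+1%:R.
have d0 : 0 < d by rewrite divr_gt0.
pose I (k : 'I_n.+1) : set (lebT R) :=
  [set x : R | k%:R * d <= x < k.+1%:R * d].
have mI k : measurable (I k) by exact: measurable_itvco.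
have lI k : leb R (I k) = d%:E.
  rewrite /I leb_itvco ?ler_wpM2r ?ler_nat ?(ltW d0)//.
  by rewrite -mulrBl -natrB// subSnn mul1r.
have sI k : si (fun x => (\1_(I k) x)%:C).
  by apply: (square_integrable_indic (mI k)); rewrite lI ltry.
have IE (i k : 'I_n.+1) (x : R) : I k x -> \1_(I i) x = (i == k)%:R :> R.
  move=> kx; rewrite indicE; congr (nat_of_bool _)%:R.
  apply/idP/eqP => [/set_mem ix|->]; last exact/mem_set.
  move: ix kx => /andP[i1 i2] /andP[k1 k2].
  (* A common point of intervals [i] and [k] gives [i * d < (k + 1) * d] and [k * d < (i + 1) * d],
     hence [i <= k] and [k <= i]. *)
  apply/val_inj/eqP; rewrite eqn_leq; apply/andP; split;
    rewrite -ltnS -(ltr_nat R) -(ltr_pM2r d0).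
    exact: le_lt_trans i1 k2.
  exact: le_lt_trans k1 i2.
pose f k : L2fun R := insubd 0 ((fun x => (\1_(I k) x)%:C) : lebT R -> R[i]^o).
have fE k : val (f k) = (fun x => (\1_(I k) x)%:C).
  by rewrite insubdK//; exact/asboolP.
exists (fun k => L2class (fun x => (\1_(I k) x)%:C)); split.
  move=> k; have := L2repr_class (sI k).
  apply: filterS => x + tx.
  have x0 : 0 <= x by exact: ltW (lt_le_trans t0 tx).
  move=> /(_ x0) ->; rewrite indicE memNset// => /andP[_]; apply/negP.
  rewrite -leNgt (le_trans _ tx)// /d mulrC mulrAC -mulrA ler_piMr ?(ltW t0)//.
  by rewrite ler_pdivrMr// mul1r ler_nat.
(* The combination is lifted to the actual indicator functions, whose values are known at every
   point, unlike those of chosen representatives. *)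
move=> c; have -> : \sum_i c i *: L2class (fun x => (\1_(I i) x)%:C) =
    \pi_(L2 R)%qT (\sum_i c i *: f i).
  by rewrite raddf_sum; apply: eq_bigr => i _; exact: pi_L2scale.
have -> : (0 : L2 R) = \pi_(L2 R)%qT 0 by rewrite raddf0.
move=> /pi_L2P c0 k.
(* At a point of [I k] where the relation holds, only the term of index [k] survives, with value
   [c k]. *)
have [|x Ik] := ae_witness (mI k) _ c0; first by rewrite lI lte_fin.
have x0 : 0 <= x.
  by case/andP: Ik => + _; apply: le_trans; rewrite mulr_ge0// ltW.
have cfE i : (c i *: sval (f i)) x = c i * (i == k)%:R%:C.
  by rewrite -[LHS]/(c i * val (f i) x) fE (IE _ _ _ Ik).
move=> /(_ x0); rewrite raddf_sum fct_sumE (bigD1 k)//= big1 => [|i ik].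
  by rewrite cfE eqxx mulr1 addr0.
by rewrite cfE (negbTE ik) mulr0.
Qed.

End Characteristic.

Theorem lemma3p2 (R : realType) (phi : R -> R) (hphi : is_symbol phi)
    (t : R) (ht : 0 < t) :
  ker (L2adjoint (wtsemigroup phi t)) = chiL2 [set x : R | 0 <= x < t] /\
  infinite_dimensional (ker (L2adjoint (wtsemigroup phi t))).
Proof.
have kerP := ker_wtsemigroup_adjointP hphi (ltW ht).
split.
  apply/seteqP; split => G.
    move=> /kerP G0; apply/chiL2P; first exact: measurable_itvco.
    apply: filterS G0 => x G0 x0 nx; apply: G0.
    by rewrite leNgt; apply/negP => xt; apply: nx; apply/andP.
  move=> /(chiL2P _ (measurable_itvco 0 t)) G0; apply/kerP.
  apply: filterS G0 => x G0 tx; apply: G0.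
    exact: le_trans (ltW ht) tx.
  by move=> /andP[_]; rewrite ltNge tx.
apply: infinite_dimensional_free => n.
have [u [u0 ufree]] := L2_free_subintervals n ht.
by exists u; split => // i; apply/kerP.
Qed.
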